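(* Let $p\ge2$ and $U\in\mathcal{S}_p$. Then for every $\lambda>0$, $$\Lambda_p(U,\lambda U)=\left(|\lambda-1|^pA_p+|\lambda^2-1|^{p/2}M_p\right)^{1/p},$$ where $A_p:=\mathbf{E}(|Z_{\tau_U}|^p)$ and $M_p:=\mathbf{E}(\tau_U^{p/2})$.
   Context: A domain is a nonempty connected open proper subset of $\mathbb{C}$. $(Z_t)_{t\ge0}$ denotes a standard planar Brownian motion started at $0$, and for a domain $D\ni0$, $\tau_D:=\inf\{t\ge0: Z_t\notin D\}$; $\mu_D$ denotes the joint law of the exit pair $(Z_{\tau_D},\tau_D)$ on $\mathbb{C}\times[0,\infty)$. $\lambda U:=\{\lambda z:z\in U\}$. $\mathcal{S}_p$ is the set of proper simply connected domains $U\subsetneq\mathbb{C}$ with $0\in U$ and $\mathbf{E}(|Z_{\tau_U}|^p)<\infty$ (for such simply connected domains this is equivalent to $\mathbf{E}(\tau_U^{p/2})<\infty$). $\Pi(\mu,\nu)$ is the set of probability measures with marginals $\mu$ and $\nu$, and $$\Lambda_p(U,V):=\inf_{\pi\in\Pi(\mu_U,\mu_V)}\left(\int\left(|z-w|^p+|t-s|^{p/2}\right)d\pi\bigl((z,t),(w,s)\bigr)\right)^{1/p}.$$ *)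

(* Defs.v *)
From HB Require Import structures.
From mathcomp Require Import all_boot all_order all_algebra.
From mathcomp Require Import all_classical all_reals all_analysis.

Set Implicit Arguments.
Unset Strict Implicit.
Unset Printing Implicit Defensive.

Import Order.TTheory GRing.Theory Num.Theory.
Import numFieldNormedType.Exports.

Local Open Scope classical_set_scope.
Local Open Scope ring_scope.

(* The complex plane is modelled by R * R with its product topology and
   product sigma-algebra; only its real vector space structure is used. *)

(* The library norm on R * R is the sup norm, hence this Euclidean modulus. *)
Definition modulus (R : realType) (z : R * R) : R :=
  Num.sqrt (z.1 ^+ 2 + z.2 ^+ 2).

Definition dilate (R : realType) (l : R) (U : set (R * R)) : set (R * R) :=
  [set (l * z.1, l * z.2) | z in U].

Definition is_domain (R : realType) (D : set (R * R)) : Prop :=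
  [/\ D !=set0, connected D, open D & D != setT].

Definition null_homotopic_in (R : realType) (U : set (R * R))
    (g : R -> R * R) : Prop :=
  exists H : R * R -> R * R,
    [/\ {within `[0, 1] `*` `[0, 1], continuous H},
        (forall s t, 0 <= s <= 1 -> 0 <= t <= 1 -> U (H (s, t))),
        (forall t, 0 <= t <= 1 -> H (0, t) = g t),
        (forall t, 0 <= t <= 1 -> H (1, t) = g 0) &
        (forall s, 0 <= s <= 1 -> H (s, 0) = g 0 /\ H (s, 1) = g 0)].

(* For open sets of the plane, connected and path-connected coincide. *)
Definition simply_connected (R : realType) (U : set (R * R)) : Prop :=
  connected U /\
  forall g : R -> R * R,
    {within `[0, 1], continuous g} ->
    (forall t, 0 <= t <= 1 -> U (g t)) ->
    g 0 = g 1 ->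
    null_homotopic_in U g.

(* Taking some of the A i to be setT gives the product rule for all
   subfamilies. *)
Definition mutually_independent (R : realType) (d d' : measure_display)
    (Omega : measurableType d) (T : measurableType d')
    (P : probability Omega R) (I : finType) (X : I -> Omega -> T) : Prop :=
  forall A : I -> set T, (forall i, measurable (A i)) ->
    P (\bigcap_(i in [set: I]) (X i @^-1` A i)) =
    (\prod_(i : I) P (X i @^-1` A i))%E.

(* Only the times t >= 0 of Z are constrained. The second argument of
   normal_prob is the standard deviation, so that increments over [s, t] have
   law N(0, (t - s) I_2). *)
Definition planar_brownian_motion (R : realType) (d : measure_display)
    (Omega : measurableType d) (P : probability Omega R)
    (Z : R -> Omega -> R * R) : Prop :=
  [/\ (forall t, 0 <= t -> measurable_fun [set: Omega] (Z t)),
      (forall w, Z 0 w = (0, 0)),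
      (forall w, {within `[0, +oo[, continuous (fun t => Z t w)}),
      (forall (n : nat) (t : nat -> R), 0 <= t 0%N ->
         {homo t : i j / (i <= j)%N >-> i <= j} ->
         mutually_independent P
           (fun (i : 'I_n) (w : Omega) => Z (t i.+1) w - Z (t i) w)) &
      (forall (s t : R) (A : set (R * R)), 0 <= s -> s < t -> measurable A ->
         pushforward P (fun w => Z t w - Z s w) A =
         (normal_prob 0 (Num.sqrt (t - s)) \x
          normal_prob 0 (Num.sqrt (t - s)))%E A)].

Section exit.
Context (R : realType) (d : measure_display) (Omega : measurableType d).
Context (P : probability Omega R) (Z : R -> Omega -> R * R).

Definition exit_time (D : set (R * R)) (w : Omega) : \bar R :=
  ereal_inf [set t%:E | t in [set t : R | 0 <= t /\ ~ D (Z t w)]].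

(* The exit pair is only meaningful where the exit time is finite, which is
   almost everywhere for simply connected proper domains; as fine +oo = 0, it
   takes the conventional value (Z 0 w, 0) elsewhere. *)
Definition exit_pair (D : set (R * R)) (w : Omega) : (R * R) * R :=
  let tau := fine (exit_time D w) in (Z tau w, tau).

(* A measure on plane * R, carried by plane * [0, +oo[. *)
Definition exit_law (D : set (R * R)) : set ((R * R) * R) -> \bar R :=
  pushforward P (exit_pair D).

Definition exit_position_moment (p : R) (D : set (R * R)) : \bar R :=
  ('E_P[fun w => (modulus (exit_pair D w).1 `^ p)%R])%E.

Definition exit_time_moment (p : R) (D : set (R * R)) : \bar R :=
  ('E_P[fun w => ((exit_pair D w).2 `^ (p / 2))%R])%E.

Definition S_class (p : R) (U : set (R * R)) : Prop :=
  [/\ is_domain U, simply_connected U, U (0, 0) &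
      (exit_position_moment p U < +oo)%E].

End exit.

Definition couplings (R : realType) (d1 d2 : measure_display)
    (T1 : measurableType d1) (T2 : measurableType d2)
    (mu : set T1 -> \bar R) (nu : set T2 -> \bar R) :
    set (probability (T1 * T2)%type R) :=
  [set pi | (forall A, measurable A -> pi (A `*` [set: T2]) = mu A) /\
            (forall B, measurable B -> pi ([set: T1] `*` B) = nu B)].

Definition transport_cost (R : realType) (p : R)
    (x : ((R * R) * R) * ((R * R) * R)) : R :=
  modulus (x.1.1 - x.2.1) `^ p + `|x.1.2 - x.2.2| `^ (p / 2).

Definition exit_distance (R : realType) (d : measure_display)
    (Omega : measurableType d) (P : probability Omega R)
    (Z : R -> Omega -> R * R) (p : R) (U V : set (R * R)) : \bar R :=
  ereal_inf [set ((\int[pi]_x (transport_cost p x)%:E) `^ p^-1)%E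
            | pi in couplings (exit_law P Z U) (exit_law P Z V)].

(* Main.v *)
Require Import Defs.
From HB Require Import structures.
From mathcomp Require Import all_boot all_order all_algebra.
From mathcomp Require Import all_classical all_reals all_analysis.
From mathcomp Require Import measurable_realfun.
From mathcomp Require Import ring lra.
Import Order.TTheory GRing.Theory Num.Theory.
Import numFieldNormedType.Exports.
Local Open Scope classical_set_scope.
Local Open Scope ring_scope.

(** Write [E = (Z_tau, tau)] for the exit pair of [U], and put [S_l (z, t) :=
    (l z, l^2 t)].  The rescaled process [l^-1 Z_(l^2 t)] is again a planar
    Brownian motion, and its exit pair from [U] is carried by [S_l] to the exit
    pair of [Z] from [l U].  As the law of the exit pair depends only on the law
    of the process, the exit law of [l U] is the law of [S_l E].  The pair
    [(E, S_l E)] is therefore a coupling, and its cost is exactly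
    [|l - 1|^p A_p + |l^2 - 1|^(p/2) M_p].

    This coupling is optimal, and the spatial and the temporal parts of the cost
    are bounded below separately.  Let [u] and [v] be the moduli (or the absolute
    values) of the two coordinates, so that [v] has the law of [k u], say with
    [k > 1].  Convexity of the [q]-th power gives
    [(k-1)^(q-1) k^(1-q) v^q <= (k-1)^(q-1) u^q + c^q] whenever [v <= u + c]
    ([powR_convex_lb]).  If [E u^q] is finite, integrating and subtracting yields
    [(k-1)^q E u^q <= E c^q].  To do without finiteness, both sides are truncated
    at a level [n] before subtracting, and Fatou's lemma is applied
    ([mean_transport_lb]); hence neither the finiteness of [M_p] (a
    Burkholder-type statement) nor the almost sure finiteness of the exit time
    is needed.  The case [k < 1] follows by exchanging the two marginals
    ([power_transport_lb]).

    Uniqueness in law of the exit pair ([brownian_exit_law_unique]) is obtained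
    on the space of continuous paths with the sigma-algebra generated by the
    coordinates.  The laws of two Brownian motions agree on the sigma-algebra
    generated by the increments over a finite grid of times, by independence of
    increments and uniqueness of measures on a pi-system; every finite-dimensional
    cylinder lies in such a sigma-algebra, and the cylinders form a generating
    pi-system.  The exit pair of an open set is a measurable function of the path
    ([measurable_exit_pair]). *)

Set Implicit Arguments.
Unset Strict Implicit.
Unset Printing Implicit Defensive.

(** * Lower bound for the cost of coupling a variable with a dilated copy *)

(** If [x <= y + c] and [x] has the law of [k y], with [1 <= k], then
    [(k - 1) E y <= E c], including when [E y] is infinite. *)
Lemma mean_transport_lb (R : realType) (d : measure_display)
    (T : measurableType d) (pi : probability T R) (x y c : T -> R) (k : R) :
  1 <= k ->
  measurable_fun setT x -> measurable_fun setT y -> measurable_fun setT c ->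
  (forall w, 0 <= x w) -> (forall w, 0 <= y w) -> (forall w, 0 <= c w) ->
  (forall w, x w <= y w + c w) ->
  (forall h : R -> R, measurable_fun setT h -> (forall r : R, 0 <= r -> 0 <= h r) ->
     (\int[pi]_w (h (x w))%:E = \int[pi]_w (h (k * y w))%:E)%E) ->
  ((k - 1)%:E * \int[pi]_w (y w)%:E <= \int[pi]_w (c w)%:E)%E.
Proof.
move=> k1 mx my mc x0 y0 c0 xyc law.
have k0 : 0 <= k by apply: le_trans k1.
have yky w : y w <= k * y w by rewrite -{1}[y w]mul1r ler_wpM2r.
have mky : measurable_fun setT (fun w => k * y w).
  by apply: measurable_funM.
have mmin (f : T -> R) (n : nat) :
    measurable_fun setT f -> measurable_fun setT (fun w => Num.min (f w) n%:R).
  by move=> mf; apply: measurable_minr.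
have min0 (a : R) (n : nat) : 0 <= a -> 0 <= Num.min a n%:R.
  by move=> a0; rewrite le_min a0 ler0n.
(* f n is nonnegative, tends to (k - 1) y, and has integral at most E c. *)
pose f (n : nat) w := Num.min (k * y w) n%:R - Num.min (y w) n%:R.
have f0 n w : 0 <= f n w.
  rewrite /f subr_ge0 le_min !ge_min lexx orbT andbT.
  by rewrite yky.
have mf n : measurable_fun setT (f n).
  by apply: measurable_funB; exact: mmin.
have intf n : (\int[pi]_w (f n w)%:E <= \int[pi]_w (c w)%:E)%E.
  (* The truncated integral is finite, so that it can be cancelled. *)
  have fin : (\int[pi]_w (Num.min (y w) n%:R)%:E \is a fin_num)%E.
    rewrite ge0_fin_numE; last first.
      by apply: integral_ge0 => w _; rewrite lee_fin min0.
    apply: (@le_lt_trans _ _ (\int[pi]_w (n%:R : R)%:E)%E).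
      apply: ge0_le_integral => //.
      - by move=> w _; rewrite lee_fin min0.
      - by apply/measurable_EFinP; exact: mmin.
      - by move=> w _; rewrite lee_fin ge_min lexx orbT.
    rewrite integral_cst//; apply: lte_mul_pinfty => //.
    exact: le_lt_trans (probability_le1 pi measurableT) (ltry 1).
  have intD (g : T -> R) : (forall w, 0 <= g w) -> measurable_fun setT g ->
      (\int[pi]_w (g w)%:E + \int[pi]_w (Num.min (y w) n%:R)%:E =
       \int[pi]_w (g w + Num.min (y w) n%:R)%:E)%E.
    move=> g0 mg; under [RHS]eq_integral do rewrite EFinD.
    rewrite ge0_integralD//.
    - by move=> w _; rewrite lee_fin.
    - exact/measurable_EFinP.
    - by move=> w _; rewrite lee_fin min0.
    - by apply/measurable_EFinP; exact: mmin.
  rewrite -(leeD2rE _ _ fin) !intD//.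
  under eq_integral do rewrite /f subrK.
  have mh : measurable_fun setT (fun r : R => Num.min r n%:R).
    exact: measurable_minr.
  rewrite -(law _ mh); last by move=> r r0; rewrite /= le_min r0 ler0n.
  apply: ge0_le_integral => //.
  - by move=> w _; rewrite lee_fin min0.
  - by apply/measurable_EFinP; exact: mmin.
  - by apply/measurable_EFinP/measurable_funD => //; exact: mmin.
  move=> w _; rewrite lee_fin ge_min.
  have [_|_] := leP (y w) n%:R; first by rewrite addrC xyc.
  by rewrite lerDr c0 orbT.
rewrite -ge0_integralZl//; last 3 first.
- exact/measurable_EFinP.
- by move=> w _; rewrite lee_fin.
- by rewrite lee_fin subr_ge0.
have -> : (\int[pi]_w ((k - 1)%:E * (y w)%:E) =
           \int[pi]_w limn_einf (fun n => (f n w)%:E))%E.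
  apply: eq_integral => w _.
  have cvgf : (f n w)%:E @[n --> \oo] --> ((k - 1)%:E * (y w)%:E)%E.
    apply: cvg_near_cst.
    exists (Num.truncn (k * y w)).+1 => // n /= hn.
    have kyn : k * y w <= n%:R.
      apply: ltW; apply: (lt_le_trans (truncnS_gt _)).
      by rewrite ler_nat.
    rewrite /f (min_idPl kyn) (min_idPl (le_trans (yky w) kyn)).
    by rewrite -EFinM mulrBl mul1r.
  by have [->] := cvg_limn_einf_sup cvgf.
apply: le_trans (fatou _ measurableT _ _) _.
- by move=> n; exact/measurable_EFinP.
- by move=> n w _; rewrite lee_fin.
rewrite limn_einf_lim; apply: lime_le; first exact: is_cvg_einfs.
apply: nearW => n; apply: le_trans (intf n).
by apply: ereal_inf_lbound; exists n => /=.
Qed.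

(** Convexity of the [q]-th power applied to
    [b / k <= (1/k) a + (1 - 1/k) (c / (k - 1))]. *)
Lemma powR_convex_lb (R : realType) (q k a b c : R) :
  1 <= q -> 1 < k -> 0 <= a -> 0 <= b -> 0 <= c -> b <= a + c ->
  (k - 1) `^ (q - 1) * k `^ (1 - q) * b `^ q <=
  (k - 1) `^ (q - 1) * a `^ q + c `^ q.
Proof.
move=> q1 k1 a0 b0 c0 bac.
have k0 : 0 < k by rewrite (lt_trans _ k1).
have km0 : 0 < k - 1 by rewrite subr_gt0.
have q0 : 0 < q by rewrite (lt_le_trans _ q1).
have ki01 : 0 <= k^-1 <= 1.
  by rewrite invr_ge0 (ltW k0) invf_le1// ltW.
pose t : {i01 R} := Itv01 (andP ki01).1 (andP ki01).2.
have := @convex_powR R q q1 t a (c / (k - 1)).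
rewrite !inE /= !in_itv /= !andbT => /(_ a0 (divr_ge0 c0 (ltW km0))).
rewrite !convRE /= => cvx.
have {}cvx : (k^-1 * a + (1 - k^-1) * (c / (k - 1))) `^ q <=
    k^-1 * a `^ q + (1 - k^-1) * (c / (k - 1)) `^ q by exact: cvx.
have {cvx} cvx : (b / k) `^ q <=
    k^-1 * a `^ q + (1 - k^-1) * (c / (k - 1)) `^ q.
  apply: le_trans cvx.
  apply: ge0_ler_powR; rewrite ?nnegrE ?(ltW q0)//.
  - by rewrite divr_ge0// ltW.
  - have /andP[ki0 ki1] := ki01.
    apply: addr_ge0; apply: mulr_ge0 => //; first by rewrite subr_ge0.
    by rewrite divr_ge0// ltW.
  rewrite [leRHS](_ : _ = (a + c) / k); last first.
    by field; rewrite !gt_eqF.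
  by rewrite ler_pM2r// invr_gt0.
have powD (x : R) : 0 < x -> x `^ (q - 1) = x `^ q / x.
  by move=> x0; rewrite powRB ?powRr1 ?(ltW x0)// (gt_eqF x0) implybT.
have powI (x : R) : 0 < x -> x `^ (1 - q) = x / x `^ q.
  by move=> x0; rewrite powRB ?powRr1 ?(ltW x0)// (gt_eqF x0) implybT.
move: cvx; rewrite !powRM ?invr_ge0 ?(ltW k0) ?(ltW km0)//.
have powV (x : R) : 0 < x -> x^-1 `^ q = (x `^ q)^-1.
  by move=> x0; rewrite -powR_inv1 ?(ltW x0)// -powRrM mulN1r powRN.
rewrite !powV// => cvx.
rewrite powD// powI//.
have kq0 : 0 < k `^ q by rewrite powR_gt0.
have kmq0 : 0 < (k - 1) `^ q by rewrite powR_gt0.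
move: cvx kq0 kmq0; set K := k `^ q; set M := (k - 1) `^ q.
set A := a `^ q; set B := b `^ q; set C := c `^ q => cvx K0 M0.
have -> : M / (k - 1) * (k / K) * B = (B / K) * (M * k / (k - 1)).
  by field; rewrite !gt_eqF.
have -> : M / (k - 1) * A + C =
    (k^-1 * A + (1 - k^-1) * (C / M)) * (M * k / (k - 1)).
  by field; rewrite !gt_eqF.
by rewrite ler_pM2r// divr_gt0// mulr_gt0.
Qed.

(** Any coupling of [u] with a copy [v] of [l u] costs at least as much as the
    coupling [v = l u].  The case [l < 1] reduces to [l^-1 > 1]. *)
Lemma power_transport_lb (R : realType) (d : measure_display)
    (T : measurableType d) (pi : probability T R) (u v c : T -> R) (q l : R) :
  1 <= q -> 0 < l ->
  measurable_fun setT u -> measurable_fun setT v -> measurable_fun setT c ->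
  (forall w, 0 <= u w) -> (forall w, 0 <= v w) -> (forall w, 0 <= c w) ->
  (forall w, `|u w - v w| <= c w) ->
  (forall h : R -> R, measurable_fun setT h -> (forall r : R, 0 <= r -> 0 <= h r) ->
     (\int[pi]_w (h (v w))%:E = \int[pi]_w (h (l * u w))%:E)%E) ->
  ((`|l - 1| `^ q)%:E * \int[pi]_w (u w `^ q)%:E <=
   \int[pi]_w (c w `^ q)%:E)%E.
Proof.
move=> q1 + + + + + + + +; have q0 : 0 < q by rewrite (lt_le_trans _ q1).
have mpow (f : T -> R) : measurable_fun setT f ->
    measurable_fun setT (fun w => f w `^ q).
  by move=> mf; exact: (measurableT_comp (measurable_powR q)).
have powRDp (x r s : R) : 0 < x -> x `^ (r + s) = x `^ r * x `^ s.
  by move=> x0; rewrite powRD// (gt_eqF x0) implybT.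
have gt1 (k : R) (a b : T -> R) : 1 < k ->
    measurable_fun setT a -> measurable_fun setT b -> measurable_fun setT c ->
    (forall w, 0 <= a w) -> (forall w, 0 <= b w) -> (forall w, 0 <= c w) ->
    (forall w, `|a w - b w| <= c w) ->
    (forall h : R -> R, measurable_fun setT h ->
       (forall r : R, 0 <= r -> 0 <= h r) ->
       (\int[pi]_w (h (b w))%:E = \int[pi]_w (h (k * a w))%:E)%E) ->
    (((k - 1) `^ q)%:E * \int[pi]_w (a w `^ q)%:E <=
     \int[pi]_w (c w `^ q)%:E)%E.
  move=> k1 ma mb mc a0 b0 c0 abc law.
  have k0 : 0 < k by rewrite (lt_trans _ k1).
  have km0 : 0 < k - 1 by rewrite subr_gt0.
  pose K1 := (k - 1) `^ (q - 1); pose K2 := K1 * k `^ (1 - q).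
  have K10 : 0 <= K1 by exact: powR_ge0.
  have K20 : 0 <= K2 by rewrite mulr_ge0 ?powR_ge0.
  have kpow (r : R) : 0 <= r -> K2 * (k * r) `^ q = k * (K1 * r `^ q).
    move=> r0; rewrite /K2 powRM ?(ltW k0)//.
    have -> : k * (K1 * r `^ q) = K1 * k * r `^ q by ring.
    rewrite mulrA -[X in X * _]mulrA; congr (_ * _ * _).
    by rewrite -powRDp// subrK powRr1 ?(ltW k0).
  have mK (f : T -> R) (C : R) : measurable_fun setT f ->
      measurable_fun setT (fun w => C * f w `^ q).
    by move=> mf; apply: measurable_funM => //; exact: mpow.
  have key : ((k - 1)%:E * \int[pi]_w (K1 * a w `^ q)%:E <=
              \int[pi]_w (c w `^ q)%:E)%E.
    apply: (@mean_transport_lb _ _ _ pi (fun w => K2 * b w `^ q) _ _ k (ltW k1)).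
    - exact: mK.
    - exact: mK.
    - exact: mpow.
    - by move=> w; rewrite mulr_ge0 ?powR_ge0.
    - by move=> w; rewrite mulr_ge0 ?powR_ge0.
    - by move=> w; rewrite powR_ge0.
    - move=> w; apply: powR_convex_lb => //.
      have := abc w; rewrite distrC => /(le_trans (ler_norm _)).
      by rewrite lerBlDl.
    - move=> h mh h0.
      rewrite (law (fun r => h (K2 * r `^ q))).
      + by apply: eq_integral => w _; rewrite kpow.
      + by apply: (measurableT_comp mh); apply: measurable_funM.
      + by move=> r r0; rewrite h0// mulr_ge0// powR_ge0.
  move: key; under [X in (_ * X)%E]eq_integral do rewrite EFinM.
  rewrite ge0_integralZl//; last 2 first.
  - by apply/measurable_EFinP; exact: mpow.
  - by move=> w _; rewrite lee_fin powR_ge0.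
  rewrite muleA -EFinM.
  suff -> : (k - 1) * K1 = (k - 1) `^ q by [].
  rewrite /K1 -{1}[k - 1]powRr1 ?(ltW km0)//.
  by rewrite -powRDp// subrKC.
move=> l0 mu mv mc u0 v0 c0 uvc law.
have lawq : (\int[pi]_w (v w `^ q)%:E = (l `^ q)%:E * \int[pi]_w (u w `^ q)%:E)%E.
  rewrite (law (fun r => r `^ q)).
  - under eq_integral do rewrite powRM ?(ltW l0)// EFinM.
    rewrite ge0_integralZl//.
    + by apply/measurable_EFinP; exact: mpow.
    + by move=> w _; rewrite lee_fin powR_ge0.
    + by rewrite lee_fin powR_ge0.
  - exact: (measurable_powR q).
  - by move=> r _; exact: powR_ge0.
have [l1|l1|->] := ltgtP 1 l.
- by rewrite gtr0_norm ?subr_gt0//; exact: (gt1 l u v).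
- rewrite ltr0_norm ?subr_lt0// opprB.
  (* the roles of the two marginals are exchanged, with ratio 1 / l *)
  have := gt1 l^-1 v u; rewrite lawq muleA -EFinM.
  have -> : (l^-1 - 1) `^ q * l `^ q = (1 - l) `^ q.
    rewrite -powRM ?(ltW l0)//; last by rewrite subr_ge0 invf_ge1// ltW.
    by rewrite mulrBl mulVf ?gt_eqF// mul1r.
  apply => //.
  + by rewrite invf_gt1.
  + by move=> w; rewrite distrC.
  + move=> h mh h0; rewrite (law (fun r => h (l^-1 * r))).
    * by apply: eq_integral => w _; rewrite mulKf// gt_eqF.
    * by apply: (measurableT_comp mh); exact: measurable_funM.
    * by move=> r r0; rewrite h0// mulr_ge0// invr_ge0 ltW.
- rewrite subrr normr0 powR0 ?gt_eqF// mul0e.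
  by apply: integral_ge0 => w _; rewrite lee_fin powR_ge0.
Qed.

(** * Measurability of the exit pair *)

Lemma open_measurable_plane (R : realType) (U : set (R * R)) :
  open U -> measurable U.
Proof.
move=> oU.
pose B (i : nat * (rat * rat)) : set (R * R) :=
  ball (ratr i.2.1 : R) i.1.+1%:R^-1 `*` ball (ratr i.2.2 : R) i.1.+1%:R^-1.
(* U is the union of the rational boxes that it contains. *)
have -> : U = \bigcup_i (if `[< B i `<=` U >] then B i else set0).
  apply/seteqP; split=> [z Uz|z [i _]]; last first.
    by case: ifPn => // /asboolP BU Bz; exact: BU.
  move: (oU); rewrite openE => /(_ z Uz) /nbhs_ballP[e /= e0 zeU].
  have [n ne] : exists n : nat, (n.+1%:R^-1 : R) < e / 2.
    exists (Num.truncn (e / 2)^-1); rewrite invf_plt ?posrE ?divr_gt0//.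
    exact: truncnS_gt.
  have n0 : 0 < n.+1%:R^-1 :> R by rewrite invr_gt0.
  have approx (x : R) : exists q : rat, `|ratr q - x| < n.+1%:R^-1.
    have /rat_in_itvoo[q] : x < x + n.+1%:R^-1 by rewrite ltrDl.
    rewrite in_itv/= => /andP[xq qx]; exists q.
    by rewrite gtr0_norm ?subr_gt0// ltrBlDl.
  have [p zp] := approx z.1; have [q zq] := approx z.2.
  exists (n, (p, q)) => //; case: ifPn => [_|/asboolPn[]]; first by split.
  move=> y [/= py qy]; apply: zeU; split => /=.
  - have := ler_distD (ratr p) z.1 y.1.
    rewrite -[X in _ <= X + _ -> _]distrC => h; apply: le_lt_trans h _.
    rewrite [e]splitr; apply: ltrD; first exact: lt_trans zp ne.
    exact: lt_trans py ne.
  - have := ler_distD (ratr q) z.2 y.2.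
    rewrite -[X in _ <= X + _ -> _]distrC => h; apply: le_lt_trans h _.
    rewrite [e]splitr; apply: ltrD; first exact: lt_trans zq ne.
    exact: lt_trans qy ne.
apply: countable_bigcupT_measurable => // i; case: ifPn => // _.
by apply: measurableX; exact: measurable_ball.
Qed.

(** The points whose distance to the complement of [U], for the sup norm, is at
    least [1 / (n + 1)]. *)
Definition deep_part (R : realType) (U : set (R * R)) (n : nat) : set (R * R) :=
  [set z | ball z n.+1%:R^-1 `<=` U].

Lemma measurable_deep_part (R : realType) (U : set (R * R)) (n : nat) :
  measurable (deep_part U n).
Proof.
rewrite -[deep_part _ _]setCK; apply: measurableC; apply: open_measurable_plane.
(* The complement is a union of open balls. *)
have -> : ~` deep_part U n = \bigcup_(y in ~` U) ball y n.+1%:R^-1.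
  apply/seteqP; split=> [z /existsNP[y /not_implyP[zy Uy]]|z [y Uy yz] h].
    by exists y => //; exact: ball_sym.
  by apply: Uy; apply: h; exact: ball_sym.
by apply: bigcup_open => y _; exact: ball_open.
Qed.

Lemma path_continuousP (R : realType) (f : R -> R * R) :
  {within `[0, +oo[, continuous f} <->
  forall u, 0 <= u -> forall e, 0 < e ->
  exists2 dl : R, 0 < dl & forall v, 0 <= v -> `|v - u| < dl -> ball (f u) e (f v).
Proof.
have posE u : 0 <= u -> `[0 : R, +oo[%classic u by rewrite /= in_itv /= => ->.
split=> [/subspace_continuousP cf u u0 e e0|H].
  have /cvg_ballP/(_ e e0) := cf u (posE u u0).
  rewrite /prop_near1 /within /= => /nbhs_ballP[dl /= dl0 h]; exists dl => // v v0 vu.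
  apply: h; last by rewrite in_itv /= v0.
  by rewrite /ball /= distrC.
apply/subspace_continuousP => u; rewrite /= in_itv /= andbT => u0.
apply/cvg_ballP => e e0; have [dl dl0 hdl] := H u u0 e e0.
rewrite /prop_near1 /within /=; apply/nbhs_ballP; exists dl => // v.
rewrite /ball /= distrC in_itv /= andbT => vu v0; exact: hdl.
Qed.

(** The exit time exceeds [t] iff the path remains uniformly inside [U] at the
    countably many times [r t] with [r] rational between 0 and 1; the endpoint
    [t] is among them.  The direct implication is by compactness of the path
    over the times from 0 to [t]. *)
Lemma lt_exit_timeP (R : realType) (f : R -> R * R) (U : set (R * R)) (t : R) :
  {within `[0, +oo[, continuous f} -> open U -> 0 <= t ->
  (t%:E < ereal_inf [set u%:E | u in [set u : R | (0 <= u)%R /\ ~ U (f u)]])%E <->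
  exists n, forall r : rat, 0 <= r <= 1 -> deep_part U n (f (ratr r * t)).
Proof.
move=> cf oU t0; split=> [tinf|[n hn]].
- have inU u : 0 <= u <= t -> U (f u).
    move=> /andP[u0 ut]; apply: contrapT => nU; move: tinf.
    rewrite ltNge => /negP; apply; apply: le_trans (_ : u%:E <= t%:E)%E.
      by apply: ereal_inf_lbound; exists u.
    by rewrite lee_fin.
  have cK : compact (f @` `[0, t]).
    apply: continuous_compact; last exact: segment_compact.
    apply: continuous_subspaceW cf => u /=; rewrite !in_itv/= andbT.
    by move=> /andP[].
  have /compact_near_coveringP nc := cK.
  have [] := nc nat \oo (fun n z => ball z n.+1%:R^-1 `<=` U) _ _.
    move=> _ [u /= + <-]; rewrite in_itv /= => /inU Ufu.
    move: (oU); rewrite openE => /(_ _ Ufu) /nbhs_ballP[e /= e0 zeU].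
    have [N Ne] : exists n : nat, (n.+1%:R^-1 : R) < e / 2.
      exists (Num.truncn (e / 2)^-1); rewrite invf_plt ?posrE ?divr_gt0//.
      exact: truncnS_gt.
    exists (ball (f u) (e / 2), [set n | (N <= n)%N]) => /=.
      split; last by exists N.
      by apply: nbhsx_ballx; rewrite divr_gt0.
    move=> [z n] /= [fuz Nn] y zy; apply: zeU.
    rewrite [e]splitr; apply: ball_triangle fuz _.
    apply: le_ball zy; apply: ltW; apply: le_lt_trans Ne.
    by rewrite lef_pV2 ?posrE// ler_nat.
  move=> N _ /(_ N (leqnn N)) hN; exists N => r /andP[r0 r1].
  apply: hN; exists (ratr r * t) => //.
  rewrite /= in_itv /= mulr_ge0 ?ler0q//= ler_piMl//.
  by rewrite -(rmorph1 ratr) ler_rat.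
- pose e : R := n.+1%:R^-1.
  have e0 : 0 < e by rewrite invr_gt0.
  have inU u : 0 <= u <= t -> U (f u).
    move=> /andP[u0 ut].
    have [dl dl0 hdl] := (path_continuousP _).1 cf _ u0 _ e0.
    (* It is enough to find a rational fraction of t in the continuity window of u. *)
    suff [r r01 ru] : exists2 r : rat, 0 <= r <= 1 & `|ratr r * t - u| < dl.
      apply: (hn r r01); apply: ball_sym; apply: hdl => //.
      by rewrite mulr_ge0 ?ler0q//; case/andP: r01.
    have [u00|u_gt0] := leP u 0.
      exists 0; first by rewrite lexx ler01.
      have -> : u = 0 by apply/eqP; rewrite eq_le u00.
      by rewrite (rmorph0 ratr) mul0r subr0 normr0.
    have t_gt0 : 0 < t by exact: lt_le_trans ut.
    have /rat_in_itvoo[r] : Num.max 0 (u / t - dl / t) < u / t.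
      by rewrite gt_max divr_gt0//= ltrBlDr ltrDl divr_gt0.
    rewrite in_itv /= gt_max => /andP[/andP[r0 r1] r2].
    have ut1 : u / t <= 1 by rewrite ler_pdivrMr ?mul1r.
    exists r.
      apply/andP; split; first by rewrite -(@ler0q R) ltW.
      by rewrite -(ler_rat R) (rmorph1 ratr) ltW// (lt_le_trans r2).
    rewrite ltr_pdivlMr// in r2.
    rewrite -mulrBl ltr_pdivrMr// in r1.
    by rewrite ltr0_norm ?subr_lt0// opprB ltrBlDr addrC -ltrBlDr.
  (* By continuity at t the path stays in U a little beyond t. *)
  have Ut : U (f t) by apply: inU; rewrite t0 lexx.
  move: (oU); rewrite openE => /(_ _ Ut) /nbhs_ballP[e' /= e'0 teU].
  have [dl dl0 hdl] := (path_continuousP _).1 cf _ t0 _ e'0.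
  apply: (@lt_le_trans _ _ (t + dl)%:E); first by rewrite lte_fin ltrDl.
  apply: le_ereal_inf_tmp => _ [u [/= u0 nU] <-]; rewrite lee_fin leNgt.
  apply/negP => utdl; apply: nU.
  have [ut|tu] := leP u t; first by apply: inU; rewrite u0.
  by apply: teU; apply: hdl => //; rewrite gtr0_norm ?subr_gt0// ltrBlDl.
Qed.

Lemma exit_time_ge0 (R : realType) (d : measure_display)
    (Omega : measurableType d) (Z : R -> Omega -> R * R) (U : set (R * R))
    (w : Omega) :
  (0 <= exit_time Z U w)%E.
Proof. by apply: le_ereal_inf_tmp => _ [t [/= t0 _] <-]; rewrite lee_fin. Qed.

Lemma measurable_exit_time (R : realType) (d : measure_display)
    (Omega : measurableType d) (Z : R -> Omega -> R * R) (U : set (R * R)) :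
  (forall t, 0 <= t -> measurable_fun [set: Omega] (Z t)) ->
  (forall w, {within `[0, +oo[, continuous (fun t => Z t w)}) ->
  open U -> measurable_fun [set: Omega] (exit_time Z U).
Proof.
move=> mZ cZ oU.
apply: (measurability _ (ErealGenOInfty.measurableE R)) => _ [_ [t ->] <-].
rewrite setTI; have [t0|t0] := ltP t 0.
  rewrite (_ : _ @^-1` _ = setT)//; apply/seteqP; split => // w _ /=.
  by rewrite in_itv /= andbT (lt_le_trans _ (exit_time_ge0 _ _ _))// lte_fin.
have -> : exit_time Z U @^-1` `]t%:E, +oo[ =
    \bigcup_n \bigcap_(r in [set r : rat | 0 <= r <= 1])
      (Z (ratr r * t) @^-1` deep_part U n).
  apply/seteqP; split => [w /=|w [n _ hn] /=]; rewrite in_itv /= andbT.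
    by move=> /(lt_exit_timeP (cZ w) oU t0)[n hn]; exists n.
  by apply/(lt_exit_timeP (cZ w) oU t0); exists n.
apply: bigcupT_measurable => n.
rewrite -[X in measurable X]setCK setC_bigcap bigcup_mkcond.
apply: measurableC; apply: bigcupT_measurable_rat => r.
case: ifPn => // /set_mem /andP[r0 _]; apply: measurableC.
rewrite -[X in measurable X]setTI; apply: mZ => //.
  by rewrite mulr_ge0// ler0q.
exact: measurable_deep_part.
Qed.

(** A continuous process read at a random time is the limit of its values at the
    lower approximations [floor ((m + 1) tau) / (m + 1)] of that time. *)
Lemma measurable_at_random_time (R : realType) (d : measure_display)
    (Omega : measurableType d) (Z : R -> Omega -> R * R) (tau : Omega -> R) :
  (forall t, 0 <= t -> measurable_fun [set: Omega] (Z t)) ->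
  (forall w, {within `[0, +oo[, continuous (fun t => Z t w)}) ->
  measurable_fun [set: Omega] tau -> (forall w, 0 <= tau w) ->
  measurable_fun [set: Omega] (fun w => Z (tau w) w).
Proof.
move=> mZ cZ mtau tau0.
pose k m w := Num.truncn (m.+1%:R * tau w).
pose s m w : R := (k m w)%:R / m.+1%:R.
have mtau0 m w : 0 <= m.+1%:R * tau w by rewrite mulr_ge0.
have ms m : measurable_fun [set: Omega] (fun w => Z (s m w) w).
  move=> _ A mA; rewrite setTI.
  have -> : (fun w => Z (s m w) w) @^-1` A =
      \bigcup_j (((fun w => m.+1%:R * tau w) @^-1` `[j%:R, j.+1%:R[) `&`
                 (Z (j%:R / m.+1%:R) @^-1` A)).
    apply/seteqP; split => [w Aw|w [j _ [/= + Aw]]].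
      exists (k m w) => //; split => //=; rewrite in_itv /=.
      exact: truncn_itv.
    rewrite in_itv /= => /truncn_def kj.
    by rewrite /s /k kj.
  apply: bigcupT_measurable => j; apply: measurableI.
    rewrite -[X in measurable X]setTI.
    suff mm : measurable_fun setT (fun w => m.+1%:R * tau w) by exact: mm.
    exact: measurable_funM.
  by rewrite -[X in measurable X]setTI; apply: mZ.
have cvgs w : Z (s m w) w @[m --> \oo] --> Z (tau w) w.
  apply/cvg_ballP => e e0.
  have [dl dl0 hdl] := (path_continuousP _).1 (cZ w) _ (tau0 w) _ e0.
  exists (Num.truncn dl^-1) => // m /= hm; apply: hdl.
    by rewrite /s divr_ge0.
  have /andP[l1 l2] := truncn_itv (mtau0 m w).
  have m0 : 0 < m.+1%:R :> R by [].
  rewrite /s ler0_norm; last first.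
    by rewrite subr_le0 ler_pdivrMr// mulrC.
  rewrite opprB ltrBlDr -ltrBlDl.
  apply: (@lt_trans _ _ (tau w - m.+1%:R^-1)).
    rewrite ltrD2l ltrN2 invf_plt ?posrE//.
    by apply: (lt_le_trans (truncnS_gt _)); rewrite ler_nat.
  by rewrite ltrBlDr -[X in _ + X]mul1r -mulrDl ltr_pdivlMr// mulrC natr1.
apply/measurable_fun_pairP; split.
- apply: (@measurable_fun_cvg _ _ _ _ (fun m w => (Z (s m w) w).1)) => [m|w _].
    exact: (measurableT_comp measurable_fst (ms m)).
  apply/cvg_ballP => e e0; have /cvg_ballP/(_ e e0) := cvgs w.
  by apply: filterS => m [].
- apply: (@measurable_fun_cvg _ _ _ _ (fun m w => (Z (s m w) w).2)) => [m|w _].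
    exact: (measurableT_comp measurable_snd (ms m)).
  apply/cvg_ballP => e e0; have /cvg_ballP/(_ e e0) := cvgs w.
  by apply: filterS => m [].
Qed.

Lemma measurable_exit_pair (R : realType) (d : measure_display)
    (Omega : measurableType d) (Z : R -> Omega -> R * R) (U : set (R * R)) :
  (forall t, 0 <= t -> measurable_fun [set: Omega] (Z t)) ->
  (forall w, {within `[0, +oo[, continuous (fun t => Z t w)}) ->
  open U -> measurable_fun [set: Omega] (exit_pair Z U).
Proof.
move=> mZ cZ oU.
have mtau : measurable_fun [set: Omega] (fun w => fine (exit_time Z U w)).
  apply: (measurableT_comp (fine_measurable measurableT)).
  exact: measurable_exit_time.
apply: measurable_fun_pair => //.
apply: measurable_at_random_time => // w.
by rewrite fine_ge0// exit_time_ge0.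
Qed.

(** * Uniqueness in law of planar Brownian motion and of its exit pair *)

(** The law of [f], as a probability measure. *)
Definition law_of (d d' : measure_display) (T : measurableType d)
    (T' : measurableType d') (R : realType) (P : probability T R) (f : T -> T')
    (mf : measurable_fun [set: T] f) : probability T' R :=
  distribution P (mfun_Sub (mem_set mf)).

(** Continuous paths started at the origin.  A path is a function on all of [R],
    of which only the values at nonnegative times are constrained. *)
Definition planar_path (R : realType) : Type :=
  {f : R -> R * R | {within `[0, +oo[, continuous f} /\ f 0 = (0, 0)}.

Lemma zero_pathP (R : realType) :
  {within `[0 : R, +oo[, continuous (fun _ : R => (0, 0) : R * R)} /\
  (fun _ : R => (0, 0) : R * R) 0 = (0, 0).
Proof. by split => //; apply: continuous_subspaceT => x; exact: cvg_cst. Qed.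

HB.instance Definition _ (R : realType) := gen_eqMixin (planar_path R).
HB.instance Definition _ (R : realType) := gen_choiceMixin (planar_path R).
HB.instance Definition _ (R : realType) :=
  isPointed.Build (planar_path R) (exist _ _ (zero_pathP R)).

(** Events prescribing the position at one time [t >= 0]. *)
Definition coordinate_sets (R : realType) : set (set (planar_path R)) :=
  [set C | exists2 t : R, 0 <= t & exists2 A : set (R * R), measurable A &
    C = [set f : planar_path R | A (sval f t)]].

(** Paths with the sigma-algebra generated by the positions at times [t >= 0]. *)
Definition path_space (R : realType) := g_sigma_algebraType (@coordinate_sets R).

(** The canonical process on the path space. *)
Definition coordinate (R : realType) (t : R) (f : path_space R) : R * R := sval f t.

Lemma measurable_coordinate (R : realType) (t : R) :
  0 <= t -> measurable_fun [set: path_space R] (coordinate t).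
Proof.
move=> t0 _ A mA; rewrite setTI; apply: sub_sigma_algebra.
by exists t => //; exists A.
Qed.

Lemma measurable_addz (R : realType) (d : measure_display)
    (T : measurableType d) (f g : T -> R * R) :
  measurable_fun [set: T] f -> measurable_fun [set: T] g ->
  measurable_fun [set: T] (fun x => f x + g x).
Proof.
move=> /measurable_fun_pairP[f1 f2] /measurable_fun_pairP[g1 g2].
by apply/measurable_fun_pairP; split; exact: measurable_funD.
Qed.

Lemma measurable_subz (R : realType) (d : measure_display)
    (T : measurableType d) (f g : T -> R * R) :
  measurable_fun [set: T] f -> measurable_fun [set: T] g ->
  measurable_fun [set: T] (fun x => f x - g x).
Proof.
move=> /measurable_fun_pairP[f1 f2] /measurable_fun_pairP[g1 g2].
by apply/measurable_fun_pairP; split; exact: measurable_funB.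
Qed.

Section increments.
Context (R : realType).

(** Events prescribing separately the [n] successive increments along the grid
    [t 0, ..., t n]. *)
Definition increment_boxes (t : nat -> R) (n : nat) : set (set (planar_path R)) :=
  [set C | exists2 A : 'I_n -> set (R * R), (forall i, measurable (A i)) &
    C = [set f : planar_path R | forall i, A i (sval f (t i.+1) - sval f (t i))]].

Lemma increment_boxes_setT t n : increment_boxes t n setT.
Proof. by exists (fun=> setT) => //; apply/seteqP; split. Qed.

Lemma increment_boxes_setI t n : setI_closed (increment_boxes t n).
Proof.
move=> _ _ [A mA ->] [B mB ->]; exists (fun i => A i `&` B i).
  by move=> i; exact: measurableI.
by apply/seteqP; split => f /= => [[hA hB] i|h]; split => // i; case: (h i).
Qed.

Lemma measurable_increment_boxes t n : (forall i, 0 <= t i) ->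
  increment_boxes t n `<=` @measurable _ (path_space R).
Proof.
move=> t0 _ [A mA ->].
have -> : [set f : planar_path R | forall i, A i (sval f (t i.+1) - sval f (t i))] =
    \bigcap_(i in [set: 'I_n])
      ((fun f : path_space R => coordinate (t i.+1) f - coordinate (t i) f)
       @^-1` A i).
  by apply/seteqP; split => f /= h i; [move=> _|]; exact: h.
apply: fin_bigcap_measurable => // i _; rewrite -[X in measurable X]setTI.
by apply: measurable_subz => //; exact: measurable_coordinate.
Qed.

(** As paths start at the origin, the position at a time of the grid is a sum of
    increments. *)
Lemma increment_boxes_coordinate t n j (A : set (R * R)) :
  t 0%N = 0 -> (j <= n)%N -> measurable A ->
  <<s increment_boxes t n >> [set f : planar_path R | A (sval f (t j))].
Proof.
move=> t0 jn; move: A.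
suff mj : measurable_fun [set: g_sigma_algebraType (increment_boxes t n)]
    (fun f => sval f (t j)).
  by move=> A mA; have := mj measurableT A mA; rewrite setTI.
elim: j jn => [_|j ih jn].
  rewrite t0 (_ : (fun _ => _) = cst (0, 0)); first exact: measurable_cst.
  by apply/funext => -[f []].
have -> : (fun f : planar_path R => sval f (t j.+1)) =
    (fun f => sval f (t j) + (sval f (t j.+1) - sval f (t j))).
  by apply/funext => f; rewrite addrC subrK.
apply: measurable_addz; first exact: ih (ltnW jn).
move=> _ A mA; rewrite setTI; apply: sub_sigma_algebra.
exists (fun i : 'I_n => if i == Ordinal jn then A else setT).
  by move=> i; case: ifP.
apply/seteqP; split => [f /= fA i|f /= /(_ (Ordinal jn))]; last by rewrite eqxx.
by case: ifPn => // /eqP ->.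
Qed.

End increments.

Section cylinders.
Context (R : realType).

(** Finite-dimensional cylinders: events prescribing separately the positions at
    finitely many times. *)
Definition cylinders : set (set (planar_path R)) :=
  [set C | exists n (t : nat -> R) (A : nat -> set (R * R)),
    [/\ (forall i, 0 <= t i), (forall i, measurable (A i)) &
     C = [set f : planar_path R | forall i, (i < n)%N -> A i (sval f (t i))]]].

Lemma cylinders_setT : cylinders setT.
Proof.
by exists 0%N, (fun=> 0), (fun=> setT); split => //; apply/seteqP; split.
Qed.

Lemma cylinders_setI : setI_closed cylinders.
Proof.
move=> _ _ [n [t [A [t0 mA ->]]]] [m [s [B [s0 mB ->]]]].
exists (n + m)%N, (fun i => if (i < n)%N then t i else s (i - n)%N),
  (fun i => if (i < n)%N then A i else B (i - n)%N); split.
- by move=> i; case: ifP.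
- by move=> i; case: ifP.
apply/seteqP; split => f /= => [[hA hB] i im|h].
  case: ifPn => [|ni]; first exact: hA.
  by apply: hB; rewrite ltn_subLR// leqNgt.
split => i im.
  by have := h i; rewrite im; apply; rewrite ltn_addr.
by have := h (n + i)%N; rewrite ltn_add2l (ltnNge (n + i)) leq_addr /= addKn; exact.
Qed.

Lemma measurable_cylinders : cylinders `<=` @measurable _ (path_space R).
Proof.
move=> _ [n [t [A [t0 mA ->]]]].
have -> : [set f : planar_path R | forall i, (i < n)%N -> A i (sval f (t i))] =
    \bigcap_(i in [set i | (i < n)%N]) (coordinate (t i) @^-1` A i) by [].
apply: bigcap_measurableType => i _; rewrite -[X in measurable X]setTI.
exact: measurable_coordinate.
Qed.

Lemma measurable_path_space (C : set (path_space R)) :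
  measurable C -> <<s cylinders >> C.
Proof.
apply: sub_sigma_algebra2 => _ [t t0 [A mA ->]].
exists 1%N, (fun=> t), (fun=> A); split => //.
by apply/seteqP; split => f /= h => [[]|]//; exact: (h 0%N).
Qed.

(** The grid is [0] followed by the sorted times of the cylinder, and stays
    constant from the index [n] on. *)
Lemma cylinder_increment_boxes (C : set (planar_path R)) : cylinders C ->
  exists n (t : nat -> R), [/\ t 0%N = 0, (forall i, 0 <= t i),
    {homo t : i j / (i <= j)%N >-> i <= j} & <<s increment_boxes t n >> C].
Proof.
move=> [n [u [A [u0 mA ->]]]].
pose l := sort <=%R (map u (iota 0 n)); pose s := 0 :: l.
have size_s : size s = n.+1 by rewrite /= size_sort size_map size_iota.
have ss : sorted <=%R s.
  rewrite /s /= path_min_sorted; first exact: sort_le_sorted.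
  by apply/allP => x; rewrite mem_sort => /mapP[i _ ->].
pose t i := nth 0 s (minn i n).
have minn_s i : (minn i n < size s)%N by rewrite size_s ltnS geq_minr.
have t_homo : {homo t : i j / (i <= j)%N >-> i <= j}.
  move=> i j ij; apply: (sorted_leq_nth le_trans le_refl 0 ss).
  - by rewrite inE.
  - by rewrite inE.
  - by rewrite leq_min geq_minr andbT (leq_trans (geq_minl _ _)).
have t0 : t 0%N = 0 by rewrite /t min0n.
exists n, t; split => //; first by move=> i; rewrite -t0; exact: t_homo.
have -> : [set f : planar_path R | forall i, (i < n)%N -> A i (sval f (u i))] =
    \bigcap_(i in [set i | (i < n)%N]) [set f | A i (sval f (u i))] by [].
apply: (@bigcap_measurableType _ (g_sigma_algebraType (increment_boxes t n))).
move=> i /= ni.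
have us : u i \in s by rewrite in_cons mem_sort map_f ?orbT// mem_iota.
have idx : (index (u i) s <= n)%N by rewrite -ltnS -size_s index_mem.
have -> : u i = t (index (u i) s) by rewrite /t (minn_idPl idx) nth_index.
exact: increment_boxes_coordinate.
Qed.

End cylinders.

Section law.
Context (R : realType).

(** The path of a process, as a random element of the path space. *)
Definition to_path (Omega : Type) (Z : R -> Omega -> R * R)
    (cZ : forall w, {within `[0, +oo[, continuous (fun t => Z t w)})
    (Z0 : forall w, Z 0 w = (0, 0)) (w : Omega) : path_space R :=
  exist _ (fun t => Z t w) (conj (cZ w) (Z0 w)).

Lemma measurable_to_path (d : measure_display) (Omega : measurableType d)
    (Z : R -> Omega -> R * R)
    (cZ : forall w, {within `[0, +oo[, continuous (fun t => Z t w)})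
    (Z0 : forall w, Z 0 w = (0, 0)) :
  (forall t, 0 <= t -> measurable_fun [set: Omega] (Z t)) ->
  measurable_fun [set: Omega] (to_path cZ Z0).
Proof.
move=> mZ; apply: (@measurability _ _ _ (path_space R) _ _ (@coordinate_sets R)) => //.
move=> _ [_ [t t0 [A mA ->]] <-].
exact: (mZ t t0 measurableT A mA).
Qed.

Lemma brownian_increment_law (d d' : measure_display)
    (Omega : measurableType d) (Omega' : measurableType d')
    (P : probability Omega R) (P' : probability Omega' R)
    (Z : R -> Omega -> R * R) (Z' : R -> Omega' -> R * R) :
  planar_brownian_motion P Z -> planar_brownian_motion P' Z' ->
  forall (s t : R) (A : set (R * R)), 0 <= s -> s <= t -> measurable A ->
  P ((fun w => Z t w - Z s w) @^-1` A) = P' ((fun w => Z' t w - Z' s w) @^-1` A).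
Proof.
move=> [_ _ _ _ N] [_ _ _ _ N'] s t A s0; rewrite le_eqVlt => /predU1P[->|st] mA.
  have [A0|A0] := pselect (A 0).
    have -> : (fun w => Z t w - Z t w) @^-1` A = setT.
      by apply/seteqP; split => // w _ /=; rewrite subrr.
    have -> : (fun w => Z' t w - Z' t w) @^-1` A = setT.
      by apply/seteqP; split => // w _ /=; rewrite subrr.
    by rewrite !probability_setT.
  have -> : (fun w => Z t w - Z t w) @^-1` A = set0.
    by apply/seteqP; split => // w /=; rewrite subrr.
  have -> : (fun w => Z' t w - Z' t w) @^-1` A = set0.
    by apply/seteqP; split => // w /=; rewrite subrr.
  by rewrite !measure0.
have := N s t A s0 st mA; rewrite /pushforward => ->.
by have := N' s t A s0 st mA; rewrite /pushforward => ->.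
Qed.

(** Uniqueness in law: all planar Brownian motions induce the same law on paths. *)
Lemma brownian_path_law (d d' : measure_display)
    (Omega : measurableType d) (Omega' : measurableType d')
    (P : probability Omega R) (P' : probability Omega' R)
    (Z : R -> Omega -> R * R) (Z' : R -> Omega' -> R * R)
    (cZ : forall w, {within `[0, +oo[, continuous (fun t => Z t w)})
    (Z0 : forall w, Z 0 w = (0, 0))
    (cZ' : forall w, {within `[0, +oo[, continuous (fun t => Z' t w)})
    (Z'0 : forall w, Z' 0 w = (0, 0)) :
  planar_brownian_motion P Z -> planar_brownian_motion P' Z' ->
  forall C : set (path_space R), measurable C ->
  P (to_path cZ Z0 @^-1` C) = P' (to_path cZ' Z'0 @^-1` C).
Proof.
move=> bZ bZ'; have [mZ _ _ iZ _] := bZ; have [mZ' _ _ iZ' _] := bZ'.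
pose m := law_of P (measurable_to_path cZ Z0 mZ).
pose m' := law_of P' (measurable_to_path cZ' Z'0 mZ').
suff mm' C : measurable C -> m C = m' C by exact: mm'.
have mfin : (m setT < +oo)%E.
  by apply: (le_lt_trans (probability_le1 m measurableT)); rewrite ltry.
move=> /measurable_path_space.
apply: (@g_sigma_algebra_measure_unique _ _ (path_space R) (@cylinders R)
  (@measurable_cylinders R) (fun=> setT)) => //.
- by move=> _; exact: cylinders_setT.
- by rewrite bigcup_const.
- exact: cylinders_setI.
(* Two nested pi-system arguments: a cylinder is determined by the increments
   over a grid, and on the corresponding boxes both measures are products. *)
move=> {}C /cylinder_increment_boxes[n [t [t0 tge0 tmono]]].
apply: (@g_sigma_algebra_measure_unique _ _ (path_space R)
  (increment_boxes t n) (measurable_increment_boxes tge0) (fun=> setT)) => //.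
- by move=> _; exact: increment_boxes_setT.
- by rewrite bigcup_const.
- exact: increment_boxes_setI.
move=> _ [A mA ->].
have := iZ n t (tge0 0%N) tmono A mA.
have := iZ' n t (tge0 0%N) tmono A mA.
have capE (X : Type) (V : 'I_n -> X -> R * R) :
    \bigcap_(i in [set: 'I_n]) (V i @^-1` A i) = [set w | forall i, A i (V i w)].
  by apply/seteqP; split => w /= h i; [|move=> _]; exact: h.
rewrite !capE => E' E.
transitivity (\prod_(i < n) P ((fun w => Z (t i.+1) w - Z (t i) w)%R @^-1` A i))%E.
  exact: E.
transitivity (\prod_(i < n) P' ((fun w => Z' (t i.+1) w - Z' (t i) w)%R @^-1` A i))%E.
  apply: eq_bigr => i _; apply: (brownian_increment_law bZ bZ') => //.
  exact: tmono.
exact/esym/E'.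
Qed.

Theorem brownian_exit_law_unique (d d' : measure_display)
    (Omega : measurableType d) (Omega' : measurableType d')
    (P : probability Omega R) (P' : probability Omega' R)
    (Z : R -> Omega -> R * R) (Z' : R -> Omega' -> R * R) (U : set (R * R)) :
  planar_brownian_motion P Z -> planar_brownian_motion P' Z' -> open U ->
  forall A, measurable A -> exit_law P Z U A = exit_law P' Z' U A.
Proof.
move=> bZ bZ' oU A mA; have [_ Z0 cZ _ _] := bZ; have [_ Z'0 cZ' _ _] := bZ'.
have mE : measurable_fun [set: path_space R] (exit_pair (@coordinate R) U).
  apply: measurable_exit_pair => //; first exact: measurable_coordinate.
  by move=> f; exact: (proj1 (svalP f)).
have := brownian_path_law cZ Z0 cZ' Z'0 bZ bZ' (mE measurableT A mA).
by rewrite setTI.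
Qed.

End law.

(** * Brownian scaling *)

Lemma lebesgue_measure_dilation (R : realType) (c : R) (A : set R) :
  0 < c -> measurable A ->
  lebesgue_measure A =
  (c%:E * lebesgue_measure ( *%R c @^-1` A : set (measurableTypeR R)))%E.
Proof.
move=> c0 mA.
have mc : measurable_fun setT ( *%R c : measurableTypeR R -> measurableTypeR R).
  exact: mulrl_measurable.
apply: (@lebesgue_measure_unique _ (mscale (NngNum (ltW c0))
  (pushforward lebesgue_measure
    ( *%R c : measurableTypeR R -> measurableTypeR R)))) => //= _ [[a b]] _ <-.
rewrite /mscale /= /pushforward.
have -> : *%R c @^-1` `]a, b]%classic = `]a / c, b / c]%classic.
  apply/seteqP; split => x /=; rewrite !in_itv /= ltr_pdivrMr// ler_pdivlMr//.
    by rewrite ![c * _]mulrC.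
  by rewrite ![_ * c]mulrC.
rewrite !lebesgue_measure_itv /= !lte_fin ltr_pM2r ?invr_gt0//.
case: ifPn => _; last by rewrite mule0.
by rewrite -!EFinB -EFinM -mulrBl mulrC divfK// gt_eqF.
Qed.

Lemma normal_prob_dilation (R : realType) (c s : R) (A : set R) :
  0 < c -> s != 0 -> measurable A ->
  normal_prob 0 (c * s) A = normal_prob 0 s ( *%R c @^-1` A).
Proof.
move=> c0 s0 mA; rewrite /normal_prob.
have mc : measurable_fun setT ( *%R c : measurableTypeR R -> measurableTypeR R).
  exact: mulrl_measurable.
have mpdf (r : R) : measurable_fun setT (fun x : measurableTypeR R => (normal_pdf 0 r x)%:E).
  by apply/measurable_EFinP; exact: measurable_normal_pdf.
pose push := pushforward lebesgue_measure
  ( *%R c : measurableTypeR R -> measurableTypeR R).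
rewrite (eq_measure_integral (mscale (NngNum (ltW c0)) push)); last first.
  by move=> B mB _; exact: (lebesgue_measure_dilation c0).
rewrite ge0_integral_mscale//=; last 2 first.
- exact: measurable_funTS.
- by move=> x _; rewrite lee_fin normal_pdf_ge0.
rewrite ge0_integral_pushforward//; last 2 first.
- exact: measurable_funTS.
- by move=> x _; rewrite lee_fin normal_pdf_ge0.
rewrite -ge0_integralZl//; last 4 first.
- by rewrite -[X in measurable X]setTI; exact: mc.
- by apply: measurable_funTS; exact: (measurableT_comp (mpdf _) mc).
- by move=> x _; rewrite lee_fin normal_pdf_ge0.
- by rewrite lee_fin ltW.
apply: eq_integral => x _; rewrite /= -EFinM; congr EFin.
have cs0 : c * s != 0 by rewrite mulf_neq0// gt_eqF.
rewrite !normal_pdfE// mulrA; congr (_ * _).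
  rewrite /normal_peak exprMn -mulrA -mulrnAr sqrtrM ?sqr_ge0//.
  by rewrite sqrtr_sqr gtr0_norm// invfM mulrA divff ?gt_eqF// mul1r.
rewrite /normal_fun !subr0 !exprMn; congr expR.
by field; rewrite s0 gt_eqF.
Qed.

(** The homothety of ratio [l] centred at the origin. *)
Definition scale_plane (R : realType) (l : R) (z : R * R) : R * R :=
  (l * z.1, l * z.2).

Lemma measurable_scale_plane (R : realType) (l : R) :
  measurable_fun [set: R * R] (scale_plane l).
Proof.
by apply/measurable_fun_pairP; split; apply: measurable_funM.
Qed.

Lemma scale_planeK (R : realType) (l : R) : l != 0 ->
  cancel (scale_plane l) (scale_plane l^-1).
Proof. by move=> l0 [x y]; rewrite /scale_plane /= !mulKf. Qed.

Lemma planar_normal_dilation (R : realType) (c s : R) (A : set (R * R)) :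
  0 < c -> s != 0 -> measurable A ->
  (normal_prob 0 s \x normal_prob 0 s)%E A =
  (normal_prob 0 (c * s) \x normal_prob 0 (c * s))%E
    (scale_plane c^-1 @^-1` A).
Proof.
move=> c0 s0 mA.
(* The normal laws live on the copy measurableTypeR R of R, whose sigma-algebra
   is the same but carries another display. *)
pose T := (measurableTypeR R * measurableTypeR R)%type.
have mc : measurable_fun [set: T] (scale_plane c^-1 : T -> T).
  exact: measurable_scale_plane.
have mA' : measurable (A : set T) by exact: mA.
pose push := pushforward (normal_prob 0 (c * s) \x normal_prob 0 (c * s))%E
  (scale_plane c^-1 : T -> T).
change ((normal_prob 0 s \x normal_prob 0 s)%E A = push A).
apply: product_measure_unique => // B C mB mC.
have mp (D : set R) : measurable D -> measurable ( *%R c^-1 @^-1` D).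
  by move=> mD; rewrite -[X in measurable X]setTI; exact: mulrl_measurable.
have dilE (D : set R) : measurable D ->
    normal_prob 0 (c * s) ( *%R c^-1 @^-1` D) = normal_prob 0 s D.
  move=> mD; rewrite normal_prob_dilation//; last exact: mp.
  congr (normal_prob 0 s _).
  by apply/seteqP; split => x /=; rewrite mulKf// gt_eqF.
transitivity (normal_prob 0 (c * s) ( *%R c^-1 @^-1` B) *
              normal_prob 0 (c * s) ( *%R c^-1 @^-1` C))%E.
  by apply: product_measure1E; exact: mp.
by congr (_ * _)%E; exact: dilE.
Qed.

Lemma brownian_scaling (R : realType) (d : measure_display)
    (Omega : measurableType d) (P : probability Omega R)
    (Z : R -> Omega -> R * R) (l : R) :
  0 < l -> planar_brownian_motion P Z ->
  planar_brownian_motion P (fun t w => scale_plane l^-1 (Z (l ^+ 2 * t) w)).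
Proof.
move=> l0 [mZ Z0 cZ iZ N].
have l20 : 0 < l ^+ 2 by rewrite exprn_gt0.
have sB z z' : scale_plane l^-1 z - scale_plane l^-1 z' = scale_plane l^-1 (z - z').
  by rewrite /scale_plane /= !mulrBr.
split.
- move=> t t0; apply: (measurableT_comp (measurable_scale_plane _)).
  by apply: mZ; rewrite mulr_ge0// ltW.
- by move=> w; rewrite mulr0 Z0 /scale_plane /= mulr0.
- move=> w; apply/path_continuousP => u u0 e e0.
  have [lu0 le0] : 0 <= l ^+ 2 * u /\ 0 < l * e.
    by rewrite mulr_ge0 ?mulr_gt0// ltW.
  have [dl dl0 hdl] := (path_continuousP _).1 (cZ w) _ lu0 _ le0.
  exists (dl / l ^+ 2); first by rewrite divr_gt0.
  move=> v v0; rewrite ltr_pdivlMr// => vu.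
  have lv0 : 0 <= l ^+ 2 * v by rewrite mulr_ge0// ltW.
  have lvu : `|l ^+ 2 * v - l ^+ 2 * u| < dl.
    by rewrite -mulrBr normrM gtr0_norm// mulrC.
  have [] := hdl _ lv0 lvu.
  rewrite /ball /= => h1 h2.
  have shrink (x y : R) : `|x - y| < l * e -> `|l^-1 * x - l^-1 * y| < e.
    by rewrite -mulrBr normrM gtr0_norm ?invr_gt0// ltr_pdivrMl.
  by split; exact: shrink.
- move=> n t t0 tmono A mA.
  pose B i := scale_plane l^-1 @^-1` A i.
  have mB i : measurable (B i).
    by rewrite -[X in measurable X]setTI; exact: measurable_scale_plane.
  have BE (i : 'I_n) : (fun w => scale_plane l^-1 (Z (l ^+ 2 * t i.+1) w) -
                        scale_plane l^-1 (Z (l ^+ 2 * t i) w)) @^-1` A i =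
      (fun w => Z (l ^+ 2 * t i.+1) w - Z (l ^+ 2 * t i) w) @^-1` B i.
    by apply/seteqP; split => w /=; rewrite sB.
  rewrite (eq_bigcapr (fun i _ => BE i)).
  transitivity (\prod_(i < n) P ((fun w => Z (l ^+ 2 * t i.+1) w -
      Z (l ^+ 2 * t i) w)%R @^-1` B i))%E; last first.
    by apply: eq_bigr => i _; rewrite BE.
  apply: (iZ n (fun i => l ^+ 2 * t i)) => //.
    by rewrite mulr_ge0// ltW.
  by move=> i j ij; rewrite ler_pM2l// tmono.
- move=> s t A s0 st mA.
  have mA' : measurable (scale_plane l^-1 @^-1` A).
    by rewrite -[X in measurable X]setTI; exact: measurable_scale_plane.
  have ls0 : 0 <= l ^+ 2 * s by rewrite mulr_ge0// ltW.
  have lst : l ^+ 2 * s < l ^+ 2 * t by rewrite ltr_pM2l.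
  have sdE : Num.sqrt (l ^+ 2 * t - l ^+ 2 * s) = l * Num.sqrt (t - s).
    by rewrite -mulrBr sqrtrM ?(ltW l20)// sqrtr_sqr gtr0_norm.
  have sd0 : Num.sqrt (t - s) != 0 by rewrite gt_eqF// sqrtr_gt0 subr_gt0.
  have lawE := N _ _ _ ls0 lst mA'; rewrite sdE in lawE.
  transitivity (pushforward P (fun w => Z (l ^+ 2 * t) w - Z (l ^+ 2 * s) w)
                  (scale_plane l^-1 @^-1` A)).
    rewrite /pushforward; congr (P _).
    by apply/seteqP; split => w /=; rewrite sB.
  exact: (etrans lawE (esym (planar_normal_dilation l0 sd0 mA))).
Qed.

Lemma exit_time_dilate (R : realType) (d : measure_display)
    (Omega : measurableType d) (Z : R -> Omega -> R * R) (l : R)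
    (U : set (R * R)) (w : Omega) : 0 < l ->
  exit_time Z (dilate l U) w =
  ((l ^+ 2)%:E *
   exit_time (fun t w => scale_plane l^-1 (Z (l ^+ 2 * t)%R w)) U w)%E.
Proof.
move=> l0; have l20 : 0 < l ^+ 2 by rewrite exprn_gt0.
have l_neq0 : l != 0 by rewrite gt_eqF.
have dilateE z : dilate l U z <-> U (scale_plane l^-1 z).
  split=> [[y Uy <-]|Uz]; first by rewrite (scale_planeK l_neq0).
  exists (scale_plane l^-1 z) => //; rewrite /scale_plane /= !mulVKf//.
  by case: z Uz.
rewrite /exit_time -ereal_inf_pZl//; congr ereal_inf; apply/seteqP; split.
- move=> _ [t [/= t0 nU] <-]; exists (t / l ^+ 2)%:E.
    exists (t / l ^+ 2) => //; split; first by rewrite divr_ge0// ltW.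
    by rewrite mulrC divfK ?gt_eqF//; apply: contra_not nU; exact: (dilateE _).2.
  by rewrite /= -EFinM mulrC divfK// gt_eqF.
- move=> _ [_ [t [/= t0 nU] <-] <-]; exists (l ^+ 2 * t) => //; split.
    by rewrite mulr_ge0// ltW.
  by apply: contra_not nU => /dilateE.
Qed.

(** The effect of Brownian scaling on a point of space-time. *)
Definition scale_exit (R : realType) (l : R) (x : (R * R) * R) : (R * R) * R :=
  (scale_plane l x.1, l ^+ 2 * x.2).

Lemma measurable_scale_exit (R : realType) (l : R) :
  measurable_fun [set: (R * R) * R] (scale_exit l).
Proof.
apply: measurable_fun_pair.
  exact: (measurableT_comp (measurable_scale_plane l) measurable_fst).
by apply: measurable_funM => //; exact: measurable_snd.
Qed.

(** The identity also holds where the exit time is infinite, since the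
    conventional exit pair [((0, 0), 0)] is fixed by the scaling. *)
Lemma exit_pair_dilate (R : realType) (d : measure_display)
    (Omega : measurableType d) (Z : R -> Omega -> R * R) (l : R)
    (U : set (R * R)) (w : Omega) : 0 < l ->
  exit_pair Z (dilate l U) w =
  scale_exit l
    (exit_pair (fun t w => scale_plane l^-1 (Z (l ^+ 2 * t) w)) U w).
Proof.
move=> l0; have l20 : 0 < l ^+ 2 by rewrite exprn_gt0.
rewrite /exit_pair exit_time_dilate//; set tau := exit_time _ U w.
have -> : fine ((l ^+ 2)%:E * tau)%E = l ^+ 2 * fine tau.
  have := @exit_time_ge0 _ _ _ (fun t w => scale_plane l^-1 (Z (l ^+ 2 * t) w)) U w.
  rewrite -/tau; case: tau => [r _|_|]//.
  by rewrite mulry gtr0_sg// mul1e /= mulr0.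
congr pair; rewrite -[l in scale_plane l]invrK.
by rewrite scale_planeK// invr_neq0// gt_eqF.
Qed.

(** * The distance between a domain and its dilation *)

Lemma modulus_ge0 (R : realType) (z : R * R) : 0 <= modulus z.
Proof. exact: sqrtr_ge0. Qed.

Lemma modulus_scale_plane (R : realType) (l : R) (z : R * R) :
  modulus (scale_plane l z) = `|l| * modulus z.
Proof.
by rewrite /modulus /= !exprMn -mulrDr sqrtrM ?sqr_ge0// sqrtr_sqr.
Qed.

Lemma modulusD (R : realType) (z w : R * R) :
  modulus (z + w) <= modulus z + modulus w.
Proof.
rewrite -(@ler_pXn2r _ 2)// ?nnegrE ?addr_ge0 ?modulus_ge0//.
have s0 (x y : R) : 0 <= x ^+ 2 + y ^+ 2 by rewrite addr_ge0 ?sqr_ge0.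
rewrite sqrrD !sqr_sqrtr//= -sqrtrM//.
suff : z.1 * w.1 + z.2 * w.2 <=
    Num.sqrt ((z.1 ^+ 2 + z.2 ^+ 2) * (w.1 ^+ 2 + w.2 ^+ 2)) by lra.
apply: le_trans (ler_norm _) _; rewrite -sqrtr_sqr ler_wsqrtr//.
have : 0 <= (z.1 * w.2 - z.2 * w.1) ^+ 2 by exact: sqr_ge0.
nra.
Qed.

Lemma modulus_dist (R : realType) (z w : R * R) :
  `|modulus z - modulus w| <= modulus (z - w).
Proof.
have modulusN (y : R * R) : modulus (- y) = modulus y.
  by rewrite /modulus /= !sqrrN.
have dist (a b : R * R) : modulus a - modulus b <= modulus (a - b).
  by rewrite lerBlDr -{1}(subrK b a) modulusD.
by rewrite ler_norml lerNl opprB dist -[z - w]opprB modulusN dist.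
Qed.

Lemma measurable_modulus (R : realType) :
  measurable_fun [set: R * R] (@modulus R).
Proof.
have msqrt : measurable_fun setT (@Num.sqrt R).
  by apply: continuous_measurable_fun; exact: sqrt_continuous.
apply: (measurableT_comp msqrt).
by apply: measurable_funD; apply: measurable_funX.
Qed.

Lemma ge0_integral_same_law (R : realType) (d d' d1 : measure_display)
    (T : measurableType d) (T' : measurableType d') (T1 : measurableType d1)
    (pi : probability T R) (P : probability T' R) (f : T -> T1) (X : T' -> T1)
    (g : T1 -> R) :
  measurable_fun [set: T] f -> measurable_fun [set: T'] X ->
  measurable_fun [set: T1] g -> (forall x, 0 <= g x) ->
  (forall A, measurable A -> pi (f @^-1` A) = P (X @^-1` A)) ->
  (\int[pi]_x (g (f x))%:E = \int[P]_w (g (X w))%:E)%E.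
Proof.
move=> mf mX mg g0 fX.
have mEg : measurable_fun [set: T1] (EFin \o g) by exact/measurable_EFinP.
have Eg0 x : (0 <= (EFin \o g) x)%E by rewrite lee_fin.
rewrite -(@ge0_integral_distribution _ _ _ _ _ pi (mfun_Sub (mem_set mf)) _ mEg Eg0).
rewrite -(@ge0_integral_distribution _ _ _ _ _ P (mfun_Sub (mem_set mX)) _ mEg Eg0).
by apply: eq_measure_integral => A mA _; exact: fX.
Qed.

Section dilation.
Context (R : realType) (d : measure_display) (Omega : measurableType d).
Context (P : probability Omega R) (Z : R -> Omega -> R * R) (p l : R).
Context (U : set (R * R)).
Hypotheses (bZ : planar_brownian_motion P Z) (p2 : 2 <= p) (oU : open U).
Hypothesis l0 : 0 < l.

Let X := exit_pair Z U.

Let mX : measurable_fun [set: Omega] X.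
Proof. by have [mZ _ cZ _ _] := bZ; exact: measurable_exit_pair. Qed.

Let p0 : 0 < p. Proof. exact: lt_le_trans p2. Qed.

Let p1 : 1 <= p. Proof. by apply: le_trans p2; rewrite ler1n. Qed.

Let ph1 : 1 <= p / 2. Proof. by rewrite ler_pdivlMr// mul1r. Qed.

Let l20 : 0 < l ^+ 2. Proof. by rewrite exprn_gt0. Qed.

Let X2_ge0 w : 0 <= (X w).2.
Proof. by rewrite /X /exit_pair /= fine_ge0// exit_time_ge0. Qed.

Lemma exit_law_dilate (A : set ((R * R) * R)) : measurable A ->
  exit_law P Z (dilate l U) A = P ((scale_exit l \o X) @^-1` A).
Proof.
move=> mA.
have mA' : measurable (scale_exit l @^-1` A).
  by rewrite -[X in measurable X]setTI; exact: measurable_scale_exit.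
rewrite comp_preimage -[RHS]/(exit_law P Z U (scale_exit l @^-1` A)).
rewrite (brownian_exit_law_unique bZ (brownian_scaling l0 bZ) oU mA').
rewrite /exit_law /pushforward -comp_preimage; congr (P _).
by apply/seteqP; split => w /=; rewrite exit_pair_dilate.
Qed.

(* The cost of the coupling of the exit pair with its scaled copy. *)
Let cost := (((`|l - 1| `^ p)%:E * exit_position_moment P Z p U +
      (`|l ^+ 2 - 1| `^ (p / 2))%:E * exit_time_moment P Z p U))%E.

Let mpow (d' : measure_display) (T : measurableType d') (q : R) (f : T -> R) :
  measurable_fun [set: T] f -> measurable_fun [set: T] (fun x => f x `^ q).
Proof. by move=> mf; exact: (measurableT_comp (measurable_powR q)). Qed.

Let plane_exit := ((R * R) * R)%type.

Let mdisp : measurable_fun [set: plane_exit * plane_exit]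
  (fun x => modulus (x.1.1 - x.2.1)).
Proof.
apply: (measurableT_comp (@measurable_modulus R)).
apply: measurable_subz.
  exact: (measurableT_comp measurable_fst measurable_fst).
exact: (measurableT_comp measurable_fst measurable_snd).
Qed.

Let mlag : measurable_fun [set: plane_exit * plane_exit]
  (fun x => `|x.1.2 - x.2.2|).
Proof.
apply: (measurableT_comp (@normr_measurable R setT)); apply: measurable_funB.
  exact: (measurableT_comp measurable_snd measurable_fst).
exact: (measurableT_comp measurable_snd measurable_snd).
Qed.

Lemma integral_transport_cost (pi : probability (plane_exit * plane_exit)%type R) :
  (\int[pi]_x (transport_cost p x)%:E =
   \int[pi]_x (modulus (x.1.1 - x.2.1) `^ p)%:E +
   \int[pi]_x (`|x.1.2 - x.2.2| `^ (p / 2))%:E)%E.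
Proof.
under eq_integral do rewrite /transport_cost EFinD.
rewrite ge0_integralD//.
- by move=> x _; rewrite lee_fin powR_ge0.
- by apply/measurable_EFinP; exact: mpow.
- by apply/measurable_EFinP; exact: mpow.
Qed.

Lemma coupling_cost_ge (pi : probability (plane_exit * plane_exit)%type R) :
  couplings (exit_law P Z U) (exit_law P Z (dilate l U)) pi ->
  (cost <= \int[pi]_x (transport_cost p x)%:E)%E.
Proof.
move=> [pi1 pi2].
have fstX (g : plane_exit -> R) : measurable_fun setT g -> (forall x, 0 <= g x) ->
    (\int[pi]_x (g x.1)%:E = \int[P]_w (g (X w))%:E)%E.
  move=> mg g0; apply: ge0_integral_same_law => // A mA.
  rewrite -[RHS]/(exit_law P Z U A) -pi1//; congr (pi _).
  by apply/seteqP; split => [x|x []].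
have sndX (g : plane_exit -> R) : measurable_fun setT g -> (forall x, 0 <= g x) ->
    (\int[pi]_x (g x.2)%:E = \int[P]_w (g (scale_exit l (X w)))%:E)%E.
  move=> mg g0; apply: (ge0_integral_same_law (X := scale_exit l \o X)) => //.
    exact: (measurableT_comp (measurable_scale_exit l) mX).
  move=> A mA; rewrite -exit_law_dilate// -pi2//; congr (pi _).
  by apply/seteqP; split => [x|x []].
have mm : measurable_fun [set: plane_exit] (fun x => modulus x.1).
  exact: (measurableT_comp (@measurable_modulus R) measurable_fst).
have mt : measurable_fun [set: plane_exit] (fun x => `|x.2|).
  exact: (measurableT_comp (@normr_measurable R setT) measurable_snd).
rewrite integral_transport_cost /cost; apply: leeD.
- have -> : exit_position_moment P Z p U = (\int[pi]_x (modulus x.1.1 `^ p)%:E)%E.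
    rewrite (fstX (fun x => modulus x.1 `^ p)); last by move=> x; exact: powR_ge0.
      by rewrite /exit_position_moment unlock.
    exact: mpow.
  apply: (power_transport_lb (v := fun x => modulus x.2.1)) => //.
  + exact: (measurableT_comp mm measurable_fst).
  + exact: (measurableT_comp mm measurable_snd).
  + by move=> x; exact: modulus_ge0.
  + by move=> x; exact: modulus_ge0.
  + by move=> x; exact: modulus_ge0.
  + by move=> x; exact: modulus_dist.
  + move=> h mh h0.
    rewrite (sndX (fun x => h (modulus x.1))); last 2 first.
    * exact: (measurableT_comp mh mm).
    * by move=> x; rewrite h0// modulus_ge0.
    rewrite (fstX (fun x => h (l * modulus x.1))); last 2 first.
    * by apply: (measurableT_comp mh); exact: measurable_funM.
    * by move=> x; rewrite h0// mulr_ge0 ?modulus_ge0// ltW.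
    apply: eq_integral => w _; rewrite /= modulus_scale_plane.
    by rewrite gtr0_norm.
- have -> : exit_time_moment P Z p U = (\int[pi]_x (`|x.1.2| `^ (p / 2))%:E)%E.
    rewrite (fstX (fun x => `|x.2| `^ (p / 2))); last by move=> x; exact: powR_ge0.
      rewrite /exit_time_moment unlock; apply: eq_integral => w _.
      by rewrite ger0_norm// X2_ge0.
    exact: mpow.
  apply: (@power_transport_lb _ _ _ pi (fun x => `|x.1.2|) (fun x => `|x.2.2|)
    (fun x => `|x.1.2 - x.2.2|) (p / 2) (l ^+ 2) ph1 l20) => //.
  + exact: (measurableT_comp mt measurable_fst).
  + exact: (measurableT_comp mt measurable_snd).
  + by move=> x; exact: ler_dist_dist.
  + move=> h mh h0.
    rewrite (sndX (fun x => h `|x.2|)); last 2 first.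
    * exact: (measurableT_comp mh mt).
    * by move=> x; rewrite h0.
    rewrite (fstX (fun x => h (l ^+ 2 * `|x.2|))); last 2 first.
    * by apply: (measurableT_comp mh); exact: measurable_funM.
    * by move=> x; rewrite h0// mulr_ge0// ltW.
    apply: eq_integral => w _; rewrite /= normrM.
    by rewrite gtr0_norm.
Qed.

(** The coupling of the exit pair with its own image under the scaling. *)
Lemma dilation_coupling :
  exists2 pi : probability (plane_exit * plane_exit)%type R,
    couplings (exit_law P Z U) (exit_law P Z (dilate l U)) pi &
    (\int[pi]_x (transport_cost p x)%:E = cost)%E.
Proof.
have mXX : measurable_fun [set: Omega] (fun w => (X w, scale_exit l (X w))).
  apply: measurable_fun_pair => //.
  exact: (measurableT_comp (measurable_scale_exit l) mX).
exists (law_of P mXX).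
  split => [A mA|B mB].
    rewrite -[RHS]/(P (X @^-1` A)) -[LHS]/(P (_ @^-1` (A `*` setT))).
    by congr (P _); apply/seteqP; split => [w []|w].
  rewrite exit_law_dilate// -[LHS]/(P (_ @^-1` (setT `*` B))).
  by congr (P _); apply/seteqP; split => [w []|w].
have moveE (g : plane_exit * plane_exit -> R) :
    measurable_fun setT g -> (forall x, 0 <= g x) ->
    (\int[law_of P mXX]_x (g x)%:E =
     \int[P]_w (g (X w, scale_exit l (X w)))%:E)%E.
  by move=> mg g0; apply: (ge0_integral_same_law (f := id)
    (X := fun w => (X w, scale_exit l (X w)))).
have mX1 : measurable_fun setT (fun w => modulus (X w).1).
  apply: (measurableT_comp (@measurable_modulus R)).
  exact: (measurableT_comp measurable_fst mX).
have mX2 : measurable_fun setT (fun w => (X w).2).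
  exact: (measurableT_comp measurable_snd mX).
rewrite integral_transport_cost /cost; congr (_ + _)%E.
- rewrite (moveE (fun x => modulus (x.1.1 - x.2.1) `^ p)); last 2 first.
  + exact: mpow.
  + by move=> x; exact: powR_ge0.
  rewrite /exit_position_moment unlock -ge0_integralZl//; last 2 first.
  + by apply/measurable_EFinP; exact: mpow.
  + by move=> w _; rewrite lee_fin powR_ge0.
  apply: eq_integral => w _; rewrite /= -EFinM -/X; congr EFin.
  rewrite -powRM ?modulus_ge0// distrC -modulus_scale_plane.
  by congr (modulus _ `^ _); rewrite /scale_plane !mulrBl !mul1r.
- rewrite (moveE (fun x => `|x.1.2 - x.2.2| `^ (p / 2))); last 2 first.
  + exact: mpow.
  + by move=> x; exact: powR_ge0.
  rewrite /exit_time_moment unlock -ge0_integralZl//; last 2 first.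
  + by apply/measurable_EFinP; exact: mpow.
  + by move=> w _; rewrite lee_fin powR_ge0.
  apply: eq_integral => w _; rewrite -EFinM; congr EFin.
  have lagE (t : R) : 0 <= t ->
      `|t - l ^+ 2 * t| `^ (p / 2) = `|l ^+ 2 - 1| `^ (p / 2) * t `^ (p / 2).
    move=> t0; rewrite -powRM// distrC -{2}[t]mul1r -mulrBl normrM.
    by rewrite (ger0_norm t0).
  exact: lagE (X2_ge0 w).
Qed.

Lemma exit_distance_dilate :
  exit_distance P Z p U (dilate l U) = (cost `^ p^-1)%E.
Proof.
have pV0 : 0 <= p^-1 by rewrite invr_ge0 ltW.
have cost0 : (0 <= cost)%E.
  rewrite /cost adde_ge0// mule_ge0 ?lee_fin ?powR_ge0//.
    by apply: expectation_ge0 => w; exact: powR_ge0.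
  by apply: expectation_ge0 => w; exact: powR_ge0.
apply/eqP; rewrite eq_le; apply/andP; split.
  have [pi cpi <-] := dilation_coupling.
  by apply: ereal_inf_lbound; exists pi.
apply: le_ereal_inf_tmp => _ [pi cpi <-].
have le_cost := coupling_cost_ge cpi.
apply: gt0_ler_poweR => //; rewrite in_itv /= leey andbT//.
exact: le_trans cost0 le_cost.
Qed.

End dilation.

Unset Implicit Arguments.

Theorem theorem16 (R : realType) (d : measure_display)
    (Omega : measurableType d) (P : probability Omega R)
    (Z : R -> Omega -> R * R) (p : R) (U : set (R * R)) :
  planar_brownian_motion P Z ->
  2 <= p ->
  S_class P Z p U ->
  forall l : R, 0 < l ->
    exit_distance P Z p U (dilate l U) =
    (((`|l - 1| `^ p)%:E * exit_position_moment P Z p U +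
      (`|l ^+ 2 - 1| `^ (p / 2))%:E * exit_time_moment P Z p U) `^ p^-1)%E.
Proof.
move=> bZ p2 [[_ _ oU _] _ _ _] l l0.
exact: exit_distance_dilate.
Qed.
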